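(* For all integers $x\geq1$ and $y\geq0$ and all real $t\geq0$, $$I_{x+y}(t)=\sum_{\ell=0}^{\infty}\frac{(-1)^{\ell}}{2^{\ell+1}}\left(I_1^{\ast\ell}\ast I_{x-1}\ast I_y\right)(t).$$
   Context: $I_n(t)$ denotes the modified Bessel function of the first kind of order $n$. The convolution of functions of one variable $t\ge0$ is $(f\ast g)(t)=\int_0^tf(\tau)g(t-\tau)\,d\tau$, and $I_1^{\ast\ell}$ is the $\ell$-fold convolution of $I_1$ with itself; the $0$-fold convolution acts as the identity operator, $I_1^{\ast0}\ast f=f$. *)

(* Defs.v *)
From Stdlib Require Import Reals Arith.
From Coquelicot Require Import Coquelicot.
Open Scope R_scope.

(** Modified Bessel function of the first kind of integer order [n >= 0];
    the series converges for every real [t]. *)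
Definition besselI (n : nat) (t : R) : R :=
  Series (fun k : nat => (t / 2) ^ (2 * k + n) / (INR (fact k) * INR (fact (k + n)))).

(** One-sided convolution of functions on [t >= 0]. *)
Definition conv (f g : R -> R) (t : R) : R :=
  RInt (fun tau : R => f tau * g (t - tau)) 0 t.

(** [conv_powS f k] is the convolution of [k + 1] factors [f];
    the index is shifted because the 0-fold
    convolution is not a function. *)
Fixpoint conv_powS (f : R -> R) (k : nat) : R -> R :=
  match k with
  | O => f
  | S k' => conv (conv_powS f k') f
  end.

(** The [l]-fold convolution power of [f], convolved with [g]; for [l = 0] it
    acts on [g] as the identity operator. *)
Definition conv_pow (f : R -> R) (l : nat) (g : R -> R) : R -> R :=
  match l with
  | O => g
  | S k => conv (conv_powS f k) g
  end.

(* Main.v *)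
Require Import Defs.
From Stdlib Require Import Reals Arith Lra Lia.
From Coquelicot Require Import Coquelicot.
Open Scope R_scope.

(** With [lambda = s - r] and [r ^ 2 = s ^ 2 - 1], the Laplace transform of [I_n] is
    [lambda ^ n / r], so the series is geometric with ratio [- lambda / (2 r)] and the
    claim amounts to the quadratic equation [2 r lambda + lambda ^ 2 = 1].  In the time
    domain this equation reads [I_a * I_b = 2 I_(a+b+1) + I_1 * I_(a+b+1)]; it makes the
    series telescope, with remainder [(- 1 / 2) ^ N (I_1^{*N} * I_(x+y))], which tends
    to [0] since [I_1^{*N} * I_n] is at most [exp t * t ^ N / N!].

    The convolution identities come from the recurrence [2 I_n' = I_(n-1) + I_(n+1)]:
    the difference of the two sides, as a sequence of functions indexed by [n], solves an
    infinite linear system of differential equations with zero initial data, and it is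
    bounded uniformly in [n], hence it vanishes. *)

(** * Factorials and integration of power bounds *)

Lemma INR_fact_pos (n : nat) : 0 < INR (fact n).
Proof. exact (INR_fact_lt_0 n). Qed.

Lemma INR_fact_S (n : nat) : INR (fact (S n)) = INR (S n) * INR (fact n).
Proof. now rewrite fact_simpl, mult_INR. Qed.

Lemma is_derive_pow_div_fact (A t : R) (k : nat) :
  is_derive (fun s => A * s ^ S k / INR (fact (S k))) t (A * t ^ k / INR (fact k)).
Proof.
assert (Hk := INR_fact_neq_0 k).
assert (HS : INR (S k) <> 0) by (apply not_0_INR; lia).
rewrite INR_fact_S. set (p := INR (S k)) in *.
auto_derive; trivial.
change (match k with 0%nat => 1 | S _ => INR k + 1 end) with p.
field; auto.
Qed.

(** The majorant is integrated exactly through its antiderivative. Every factorial in the later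
    estimates comes from here, one integration raising [k] by one. *)
Lemma abs_RInt_le_pow (f : R -> R) (A t : R) (k : nat) :
  0 <= t -> (forall s, continuous f s) ->
  (forall s, 0 <= s <= t -> Rabs (f s) <= A * s ^ k / INR (fact k)) ->
  Rabs (RInt f 0 t) <= A * t ^ S k / INR (fact (S k)).
Proof.
intros Ht Hc Hb.
assert (HI : is_RInt (fun s => A * s ^ k / INR (fact k)) 0 t
               (A * t ^ S k / INR (fact (S k)))).
{ replace (A * t ^ S k / INR (fact (S k)))
    with (minus (A * t ^ S k / INR (fact (S k))) (A * 0 ^ S k / INR (fact (S k)))).
  - apply (is_RInt_derive (fun s => A * s ^ S k / INR (fact (S k)))).
    + intros s _. apply is_derive_pow_div_fact.
    + intros s _. apply (ex_derive_continuous (V := R_NormedModule)).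
      auto_derive; trivial.
  - unfold minus, plus, opp; simpl. field. apply not_0_INR.
    generalize (lt_O_fact (S k)); simpl; lia. }
assert (Hf : ex_RInt f 0 t) by (apply (ex_RInt_continuous (V := R_CompleteNormedModule)); auto).
eapply Rle_trans; [now apply abs_RInt_le|].
rewrite <- (is_RInt_unique _ _ _ _ HI).
apply RInt_le; trivial.
- apply (ex_RInt_continuous (V := R_CompleteNormedModule)); intros s _.
  apply (continuous_comp f Rabs); auto. apply continuous_Rabs.
- now eexists; apply HI.
- intros s Hs. apply Hb; lra.
Qed.

(** * Convolution: symmetry, linearity, derivative, growth *)

Lemma ex_RInt_conv (f g : R -> R) (a b t : R) :
  (forall s, continuous f s) -> (forall s, continuous g s) ->
  ex_RInt (fun tau => f tau * g (t - tau)) a b.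
Proof.
intros Hf Hg. apply (ex_RInt_continuous (V := R_CompleteNormedModule)); intros s _.
apply (continuous_mult f (fun s => g (t - s))); auto.
apply (continuous_comp (fun s => t - s) g); auto.
apply (ex_derive_continuous (V := R_NormedModule)); auto_derive; trivial.
Qed.

Lemma conv_0 (f g : R -> R) : conv f g 0 = 0.
Proof. exact (RInt_point 0 _). Qed.

Lemma conv_comm (f g : R -> R) (t : R) :
  (forall s, continuous f s) -> (forall s, continuous g s) ->
  conv f g t = conv g f t.
Proof.
intros Hf Hg. unfold conv.
rewrite <- (opp_RInt_swap (fun tau => f tau * g (t - tau))); [|now apply ex_RInt_conv].
(* The substitution [tau = - s + t] exchanges the two factors and the two endpoints. *)
generalize (RInt_comp_lin (fun tau => f tau * g (t - tau)) (-1) t 0 t).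
replace (-1 * 0 + t) with t by ring. replace (-1 * t + t) with 0 by ring.
intros <-; [|now apply ex_RInt_conv].
rewrite <- RInt_opp.
- apply RInt_ext; intros s _. unfold opp, scal; simpl; unfold mult; simpl.
  replace (-1 * s + t) with (t - s) by ring.
  replace (t - (t - s)) with s by ring. ring.
- apply (ex_RInt_ext (fun s => scal (-1) (g s * f (t - s)))).
  + intros s _. unfold scal; simpl; unfold mult; simpl.
    replace (-1 * s + t) with (t - s) by ring.
    replace (t - (t - s)) with s by ring. ring.
  + apply (ex_RInt_scal (V := R_NormedModule)). now apply ex_RInt_conv.
Qed.

(** Only values on [[0, t]] enter the integral; the Bessel convolution identities are available for
    nonnegative arguments only. *)
Lemma conv_ext_r (f g h : R -> R) (t : R) : 0 <= t ->
  (forall s, 0 <= s <= t -> g s = h s) -> conv f g t = conv f h t.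
Proof.
intros Ht H. apply RInt_ext; intros s Hs.
rewrite Rmin_left, Rmax_right in Hs by lra. rewrite H; trivial; lra.
Qed.

Lemma continuous_lin (g h : R -> R) (a b t : R) :
  continuous g t -> continuous h t -> continuous (fun s => a * g s + b * h s) t.
Proof.
intros Hg Hh.
apply (continuous_plus (V := R_NormedModule) (fun s => scal a (g s)) (fun s => scal b (h s)));
  now apply (continuous_scal_r (V := R_NormedModule)).
Qed.

Lemma conv_lin_r (f g h : R -> R) (a b t : R) :
  (forall s, continuous f s) -> (forall s, continuous g s) ->
  (forall s, continuous h s) ->
  conv f (fun s => a * g s + b * h s) t = a * conv f g t + b * conv f h t.
Proof.
intros Hf Hg Hh. apply is_RInt_unique.
apply (is_RInt_ext (fun tau => plus (scal a (f tau * g (t - tau)))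
                                    (scal b (f tau * h (t - tau))))).
- intros s _. unfold plus, scal; simpl; unfold mult; simpl. ring.
- apply (is_RInt_plus (V := R_NormedModule));
    apply (is_RInt_scal (V := R_NormedModule));
    apply (RInt_correct (V := R_CompleteNormedModule)); now apply ex_RInt_conv.
Qed.

(** Leibniz rule with [t] both as parameter and as upper limit. The derivative falls on the second
    factor alone, so the first need only be continuous. *)
Lemma is_derive_conv (f h h' : R -> R) (t : R) :
  (forall s, continuous f s) -> (forall s, is_derive h s (h' s)) ->
  (forall s, continuous h' s) ->
  is_derive (conv f h) t (f t * h 0 + conv f h' t).
Proof.
intros Hf Hh Hh'.
assert (Hc : forall s, continuous h s)
  by (intros s; apply (ex_derive_continuous (V := R_NormedModule)); eexists; apply Hh).
assert (Hd : forall u v, is_derive (fun z => f v * h (z - v)) u (f v * h' (u - v))).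
{ intros u v. auto_derive; [now exists (h' (u - v)); apply Hh|].
  rewrite (is_derive_unique (fun x => h x) _ _ (Hh _)). unfold Rminus; ring. }
assert (HD : forall u v, continuity_2d_pt
          (fun u v => Derive (fun z => f v * h (z - v)) u) u v).
{ intros u v. apply (continuity_2d_pt_ext (fun u v => f v * h' (u - v))).
  - intros x y; symmetry; apply is_derive_unique, Hd.
  - apply continuity_2d_pt_mult.
    + apply (continuity_1d_2d_pt_comp f).
      * apply continuity_pt_filterlim, Hf.
      * apply continuity_2d_pt_id2.
    + apply (continuity_1d_2d_pt_comp h').
      * apply continuity_pt_filterlim, Hh'.
      * apply continuity_2d_pt_minus;
          [apply continuity_2d_pt_id1 | apply continuity_2d_pt_id2]. }
(* [f t * h (t - t)] is the integrand at the moving endpoint, and [1] is the speed of that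
   endpoint. *)
replace (f t * h 0 + conv f h' t) with
  (RInt (fun s => Derive (fun u => f s * h (u - s)) t) 0 t + f t * h (t - t) * 1).
2: { rewrite Rminus_diag. unfold conv.
  rewrite (RInt_ext _ (fun tau => f tau * h' (t - tau))).
  - ring.
  - intros s _; apply is_derive_unique, Hd. }
unfold conv.
apply (is_derive_RInt_param_bound_comp_aux3 (fun z s => f s * h (z - s)) 0 (fun z => z)).
- apply filter_forall; intros; now apply ex_RInt_conv.
- exists (mkposreal 1 Rlt_0_1); apply filter_forall; intros; now apply ex_RInt_conv.
- apply (is_derive_id (K := R_AbsRing)).
- exists (mkposreal 1 Rlt_0_1); apply filter_forall; intros x s _; eexists; apply Hd.
- intros; apply HD.
- exists (mkposreal 1 Rlt_0_1); intros; apply HD.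
- apply continuity_pt_filterlim.
  apply (continuous_mult f (fun s => h (t - s))); auto.
  apply (continuous_comp (fun s => t - s) h); auto.
  apply (ex_derive_continuous (V := R_NormedModule)); auto_derive; trivial.
Qed.

(** Since [exp s * exp (t - s) = exp t] is free of [s], the exponential weight leaves the integral
    and only [s ^ k / k!] is integrated. *)
Lemma conv_growth (f g : R -> R) (A B t : R) (k : nat) : 0 <= t ->
  (forall s, continuous f s) -> (forall s, continuous g s) ->
  (forall s, 0 <= s <= t -> Rabs (f s) <= A * exp s * s ^ k / INR (fact k)) ->
  (forall s, 0 <= s <= t -> Rabs (g s) <= B * exp s) ->
  Rabs (conv f g t) <= A * B * exp t * t ^ S k / INR (fact (S k)).
Proof.
intros Ht Hf Hg Bf Bg. apply abs_RInt_le_pow; trivial.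
- intros s. apply (continuous_mult f (fun s => g (t - s))); auto.
  apply (continuous_comp (fun s => t - s) g); auto.
  apply (ex_derive_continuous (V := R_NormedModule)); auto_derive; trivial.
- intros s Hs. rewrite Rabs_mult.
  replace (A * B * exp t * s ^ k / INR (fact k))
    with ((A * exp s * s ^ k / INR (fact k)) * (B * exp (t - s))).
  + apply Rmult_le_compat; try apply Rabs_pos; [apply Bf | apply Bg]; lra.
  + replace (exp t) with (exp s * exp (t - s)) by (rewrite <- exp_plus; f_equal; ring).
    field. apply INR_fact_neq_0.
Qed.

(** * Uniqueness for infinite linear differential systems *)

(* Iterating the system [k] times from the uniform bound [M] gives [M t^k / k!] for every [k]. *)
Lemma derive_system_unique (E : nat -> R -> R) (i j : nat -> nat) (M T : R) :
  (forall n, E n 0 = 0) ->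
  (forall n t, is_derive (E n) t ((E (i n) t + E (j n) t) / 2)) ->
  (forall n t, 0 <= t <= T -> Rabs (E n t) <= M) ->
  forall n t, 0 <= t <= T -> E n t = 0.
Proof.
intros H0 Hd HM.
assert (Hc : forall n t, continuous (E n) t)
  by (intros n t; apply (ex_derive_continuous (V := R_NormedModule)); eexists; apply Hd).
assert (Hc' : forall n t, continuous (fun t => (E (i n) t + E (j n) t) / 2) t).
{ intros n t. apply (ex_derive_continuous (V := R_NormedModule)).
  auto_derive; repeat split; eexists; apply Hd. }
assert (HE : forall k n t, 0 <= t <= T -> Rabs (E n t) <= M * t ^ k / INR (fact k)).
{ induction k as [|k IH]; intros n t Ht.
  - simpl. rewrite Rmult_1_r, Rdiv_1_r. now apply HM.
  - replace (E n t) with (RInt (fun t => (E (i n) t + E (j n) t) / 2) 0 t).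
    + apply abs_RInt_le_pow; [lra | now apply Hc' |].
      intros s Hs.
      assert (Hi := IH (i n) s ltac:(lra)). assert (Hj := IH (j n) s ltac:(lra)).
      (* The average of two functions inherits their common bound, so [M] does not grow under
         iteration. *)
      unfold Rdiv at 1. rewrite Rabs_mult, (Rabs_pos_eq (/ 2)) by lra.
      assert (Ht' := Rabs_triang (E (i n) s) (E (j n) s)). lra.
    + apply is_RInt_unique.
      replace (E n t) with (minus (E n t) (E n 0))
        by (rewrite H0; unfold minus, plus, opp; simpl; ring).
      apply (is_RInt_derive (E n)); intros; [apply Hd | apply Hc']. }
intros n t Ht.
assert (HL : is_lim_seq (fun k => M * (t ^ k / INR (fact k))) (M * 0)).
{ apply (is_lim_seq_scal_l _ M 0), is_lim_seq_Reals, cv_speed_pow_fact. }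
rewrite Rmult_0_r in HL.
assert (HL' : Rbar_le (Rabs (E n t)) 0).
{ refine (is_lim_seq_le (fun _ => Rabs (E n t)) _ _ _ _ (is_lim_seq_const _) HL).
  intros k. specialize (HE k n t Ht). unfold Rdiv in *. lra. }
simpl in HL'. apply Rabs_eq_0.
generalize (Rabs_pos (E n t)); lra.
Qed.

(** * Power series, recurrence and derivatives of the Bessel functions *)

(** Coefficients in the variable [u = (t / 2) ^ 2], once the factor [(t / 2) ^ n] is taken out;
    differentiation in [u] then just raises [n] by one. *)
Definition bessel_coef (n k : nat) : R := / (INR (fact k) * INR (fact (k + n))).

Lemma CV_radius_bessel_coef (n : nat) : CV_radius (bessel_coef n) = p_infty.
Proof.
apply CV_radius_infinite_DAlembert.
- intros k. apply Rinv_neq_0_compat, Rmult_integral_contrapositive_currified;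
    apply INR_fact_neq_0.
- apply (is_lim_seq_le_le (fun _ => 0) _ (fun k => / INR (S k))).
  + intros k. split; [apply Rabs_pos|].
    unfold bessel_coef. change (S k + n)%nat with (S (k + n)). rewrite !INR_fact_S.
    assert (Hk := INR_fact_pos k). assert (Hkn := INR_fact_pos (k + n)).
    assert (H1 : 0 < INR (S k)) by (apply lt_0_INR; lia).
    assert (H2 : 1 <= INR (S (k + n))) by (apply (le_INR 1); lia).
    replace (_ / _) with (/ INR (S k) * / INR (S (k + n))) by (field; repeat split; lra).
    assert (H3 : 0 < / INR (S k)) by now apply Rinv_0_lt_compat.
    assert (H4 : 0 < / INR (S (k + n))) by (apply Rinv_0_lt_compat; lra).
    assert (H5 : / INR (S (k + n)) <= 1) by (rewrite <- Rinv_1; apply Rinv_le_contravar; lra).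
    rewrite Rabs_pos_eq by nra. nra.
  + apply is_lim_seq_const.
  + apply (is_lim_seq_incr_1 (fun k => / INR k)).
    replace (Finite 0) with (Rbar_inv p_infty) by reflexivity.
    apply is_lim_seq_inv; [apply is_lim_seq_INR | discriminate].
Qed.

Lemma ex_series_bessel (n : nat) (u : R) : ex_series (fun k => bessel_coef n k * u ^ k).
Proof.
apply (proj1 (ex_pseries_R _ u)), CV_disk_correct, CV_disk_inside.
now rewrite CV_radius_bessel_coef.
Qed.

Lemma besselI_PSeries (n : nat) (t : R) :
  besselI n t = (t / 2) ^ n * PSeries (bessel_coef n) ((t / 2) ^ 2).
Proof.
unfold besselI, PSeries. rewrite <- Series_scal_l. apply Series_ext; intros k.
unfold bessel_coef, Rdiv. rewrite pow_add, pow_mult. ring.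
Qed.

Lemma PS_derive_bessel_coef (n k : nat) :
  PS_derive (bessel_coef n) k = bessel_coef (S n) k.
Proof.
unfold PS_derive, bessel_coef.
replace (k + S n)%nat with (S k + n)%nat by lia. rewrite (INR_fact_S k).
field. repeat split; try apply INR_fact_neq_0. apply not_0_INR; lia.
Qed.

Lemma is_derive_PSeries_bessel (n : nat) (u : R) :
  is_derive (PSeries (bessel_coef n)) u (PSeries (bessel_coef (S n)) u).
Proof.
replace (PSeries (bessel_coef (S n)) u) with (PSeries (PS_derive (bessel_coef n)) u).
- apply is_derive_PSeries. now rewrite CV_radius_bessel_coef.
- apply PSeries_ext, PS_derive_bessel_coef.
Qed.

(** Coefficientwise this is [k + n + 1 = (n + 1) + k], divided by [k! (k + n + 1)!]. In terms of [t]
    it is the classical [I_n - I_(n+2) = (2 (n + 1) / t) I_(n+1)], in a form that makes sense at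
    [t = 0]. *)
Lemma PSeries_bessel_recurrence (n : nat) (u : R) :
  PSeries (bessel_coef n) u
  = INR (S n) * PSeries (bessel_coef (S n)) u + u * PSeries (bessel_coef (S (S n))) u.
Proof.
assert (H := is_derive_unique _ _ _ (is_derive_PSeries_bessel (S n) u)).
rewrite Derive_PSeries in H by now rewrite CV_radius_bessel_coef.
(* The last term becomes [u] times the derivative of the series of order [S n], whose coefficient at
   [k] is [k * bessel_coef (S n) k]. *)
rewrite <- H, <- PSeries_incr_1. unfold PSeries at 2 3.
rewrite <- Series_scal_l, <- Series_plus.
- apply Series_ext; intros k. unfold PS_incr_1, PS_derive, bessel_coef.
  destruct k as [|k]; cbv beta iota.
  + change (0 + S n)%nat with (S n); change (0 + n)%nat with n.
    rewrite (INR_fact_S n). change (INR (fact 0)) with 1; change zero with 0.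
    field. split; [apply INR_fact_neq_0 | apply not_0_INR; lia].
  + replace (S k + S n)%nat with (S (S k + n)) by lia.
    rewrite (INR_fact_S (S k + n)), (INR_fact_S k).
    rewrite (S_INR (S k + n)), plus_INR, !S_INR.
    assert (0 <= INR k) by apply pos_INR. assert (0 <= INR n) by apply pos_INR.
    field. repeat split; try apply INR_fact_neq_0; lra.
- apply (ex_series_scal_l (V := R_NormedModule) (INR (S n))
           (fun k => bessel_coef (S n) k * u ^ k)), ex_series_bessel.
- apply (proj1 (ex_pseries_R _ u)), ex_pseries_incr_1, (proj2 (ex_pseries_R _ u)).
  apply (ex_series_ext (fun k => bessel_coef (S (S n)) k * u ^ k));
    [|apply ex_series_bessel].
  intros k. now rewrite PS_derive_bessel_coef.
Qed.

(** Order 0 stands apart: the general formula would involve [I_(-1)], which equals [I_1]. *)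
Lemma is_derive_besselI_0 (t : R) : is_derive (besselI 0) t (besselI 1 t).
Proof.
apply (is_derive_ext (fun t => (t / 2) ^ 0 * PSeries (bessel_coef 0) ((t / 2) ^ 2)));
  [intros s; symmetry; apply besselI_PSeries|].
rewrite besselI_PSeries.
auto_derive; [repeat split; eexists; apply is_derive_PSeries_bessel|].
rewrite (is_derive_unique (fun x => PSeries _ x) _ _ (is_derive_PSeries_bessel _ _)).
simpl. unfold Rdiv. field.
Qed.

Lemma is_derive_besselI_S (n : nat) (t : R) :
  is_derive (besselI (S n)) t ((besselI n t + besselI (S (S n)) t) / 2).
Proof.
apply (is_derive_ext (fun t => (t / 2) ^ S n * PSeries (bessel_coef (S n)) ((t / 2) ^ 2)));
  [intros s; symmetry; apply besselI_PSeries|].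
rewrite !besselI_PSeries, (PSeries_bessel_recurrence n).
auto_derive; [repeat split; eexists; apply is_derive_PSeries_bessel|].
rewrite (is_derive_unique (fun x => PSeries _ x) _ _ (is_derive_PSeries_bessel _ _)).
change (match n with 0%nat => 1 | S _ => INR n + 1 end) with (INR (S n)).
simpl. unfold Rdiv. field.
Qed.

Lemma besselI_0_0 : besselI 0 0 = 1.
Proof.
rewrite besselI_PSeries. replace ((0 / 2) ^ 2) with 0 by field.
rewrite PSeries_0. unfold bessel_coef; simpl. field.
Qed.

Lemma besselI_S_0 (n : nat) : besselI (S n) 0 = 0.
Proof. rewrite besselI_PSeries. replace (0 / 2) with 0 by field. simpl; ring. Qed.

Lemma continuous_besselI (n : nat) (t : R) : continuous (besselI n) t.
Proof.
apply (ex_derive_continuous (V := R_NormedModule)). destruct n as [|n];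
  eexists; [apply is_derive_besselI_0 | apply is_derive_besselI_S].
Qed.

(** * Exponential bounds, uniform in the order *)

Lemma exp_nondecreasing (s t : R) : s <= t -> exp s <= exp t.
Proof.
intros [H | ->]; [now apply Rlt_le, exp_increasing | apply Rle_refl].
Qed.

Lemma is_series_exp (h : R) : is_series (fun k => / INR (fact k) * h ^ k) (exp h).
Proof. apply (proj1 (is_pseries_R _ _ _)), is_exp_Reals. Qed.

Lemma pow_div_fact_le_exp (h : R) (n : nat) : 0 <= h -> h ^ n / INR (fact n) <= exp h.
Proof.
intros Hh.
assert (Hp : forall k, 0 <= / INR (fact k) * h ^ k).
{ intros k. apply Rmult_le_pos; [|now apply pow_le].
  apply Rlt_le, Rinv_0_lt_compat, INR_fact_pos. }
assert (Hs := is_series_exp h).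
replace (h ^ n / INR (fact n)) with (/ INR (fact n) * h ^ n) by (unfold Rdiv; ring).
apply Rle_trans with (sum_f_R0 (fun k => / INR (fact k) * h ^ k) n).
- destruct n as [|n]; [apply Rle_refl|].
  assert (H := cond_pos_sum _ n Hp). rewrite tech5. lra.
- apply sum_incr; trivial. now apply is_series_Reals.
Qed.

(** In each term [(t / 2) ^ (k + n) / (k + n)!] is at most [exp (t / 2)], and the remaining factors
    sum to [exp (t / 2)]. Uniformity in [n] is what the uniqueness argument requires. *)
Lemma abs_besselI_le (n : nat) (t : R) : 0 <= t -> Rabs (besselI n t) <= exp t.
Proof.
intros Ht. assert (Hh : 0 <= t / 2) by lra.
assert (Hs := is_series_exp (t / 2)).
assert (Hb : forall k, 0 <= (t / 2) ^ (2 * k + n) / (INR (fact k) * INR (fact (k + n)))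
               <= exp (t / 2) * (/ INR (fact k) * (t / 2) ^ k)).
{ intros k. assert (Hk := INR_fact_pos k). assert (Hkn := INR_fact_pos (k + n)).
  replace ((t / 2) ^ (2 * k + n) / (INR (fact k) * INR (fact (k + n))))
    with ((t / 2) ^ (k + n) / INR (fact (k + n)) * (/ INR (fact k) * (t / 2) ^ k)).
  2: { replace (2 * k + n)%nat with (k + n + k)%nat by lia. rewrite (pow_add _ (k + n)).
       field. lra. }
  assert (H1 := pow_le (t / 2) k Hh). assert (H2 := pow_le (t / 2) (k + n) Hh).
  assert (H3 := Rinv_0_lt_compat _ Hk). assert (H4 := Rinv_0_lt_compat _ Hkn).
  split.
  - apply Rmult_le_pos; apply Rmult_le_pos; lra.
  - apply Rmult_le_compat_r; [apply Rmult_le_pos; lra | now apply pow_div_fact_le_exp]. }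
assert (He : ex_series (fun k => exp (t / 2) * (/ INR (fact k) * (t / 2) ^ k)))
  by (apply (ex_series_scal_l (V := R_NormedModule) (exp (t / 2))
              (fun k => / INR (fact k) * (t / 2) ^ k)); now eexists; apply Hs).
unfold besselI. rewrite Rabs_pos_eq.
- eapply Rle_trans; [apply (Series_le _ _ Hb He)|].
  rewrite Series_scal_l, (is_series_unique _ _ Hs), <- exp_plus.
  right; f_equal; field.
(* The zero series, written as [0 * 0] so that a factor 0 can be pulled out of the sum. *)
- apply Rle_trans with (Series (fun _ : nat => 0 * 0)).
  + rewrite Series_scal_l. lra.
  + apply Series_le; [intros k; destruct (Hb k); lra|].
    eapply (ex_series_le (V := R_CompleteNormedModule)); [|exact He].
    intros k. destruct (Hb k). unfold norm; simpl; unfold abs; simpl.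
    rewrite Rabs_pos_eq; trivial.
Qed.

(** * Derivatives of convolutions with Bessel functions *)

(** The boundary value [I_0(0) = 1] makes [f] reappear as a source term; for higher orders
    [I_n(0) = 0] and no source arises. *)
Lemma is_derive_conv_besselI_0 (f : R -> R) (t : R) :
  (forall s, continuous f s) ->
  is_derive (conv f (besselI 0)) t (f t + conv f (besselI 1) t).
Proof.
intros Hf. replace (f t) with (f t * besselI 0 0) by (rewrite besselI_0_0; ring).
apply is_derive_conv; trivial; [apply is_derive_besselI_0 | apply continuous_besselI].
Qed.

Lemma is_derive_conv_besselI_S (f : R -> R) (n : nat) (t : R) :
  (forall s, continuous f s) ->
  is_derive (conv f (besselI (S n))) t
    ((conv f (besselI n) t + conv f (besselI (S (S n))) t) / 2).
Proof.
intros Hf.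
replace ((conv f (besselI n) t + conv f (besselI (S (S n))) t) / 2)
  with (f t * besselI (S n) 0
        + conv f (fun s => / 2 * besselI n s + / 2 * besselI (S (S n)) s) t).
- apply (is_derive_conv f (besselI (S n))); trivial.
  + intros s. replace (/ 2 * besselI n s + / 2 * besselI (S (S n)) s)
      with ((besselI n s + besselI (S (S n)) s) / 2) by field.
    apply is_derive_besselI_S.
  + intros s. apply continuous_lin; apply continuous_besselI.
- rewrite conv_lin_r, besselI_S_0; trivial; try (intros; apply continuous_besselI).
  field.
Qed.

Lemma continuous_conv_besselI (f : R -> R) (n : nat) (t : R) :
  (forall s, continuous f s) -> continuous (conv f (besselI n)) t.
Proof.
intros Hf. apply (ex_derive_continuous (V := R_NormedModule)). destruct n as [|n];
  eexists; [now apply is_derive_conv_besselI_0 | now apply is_derive_conv_besselI_S].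
Qed.

Lemma abs_conv_besselI_le (a b : nat) (t : R) :
  0 <= t -> Rabs (conv (besselI a) (besselI b) t) <= exp t * t.
Proof.
intros Ht. replace (exp t * t) with (1 * 1 * exp t * t ^ 1 / INR (fact 1)) by (simpl; field).
apply conv_growth; trivial; try (intros; apply continuous_besselI);
  intros s Hs; generalize (abs_besselI_le a s ltac:(lra)) (abs_besselI_le b s ltac:(lra));
  simpl; lra.
Qed.

Lemma exp_mul_le (s T : R) : 0 <= s <= T -> exp s * s <= exp T * T.
Proof.
intros Hs. apply Rmult_le_compat; try lra; [apply Rlt_le, exp_pos|].
apply exp_nondecreasing; lra.
Qed.

(** * Convolution identities between Bessel functions *)

Lemma besselI_conv_quadratic (n : nat) (t : R) : 0 <= t ->
  conv (besselI 0) (besselI n) t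
  = 2 * besselI (S n) t + conv (besselI 1) (besselI (S n)) t.
Proof.
intros Ht.
(* Setting [E 0 := 0] closes the system: [E 1' = E 2 / 2]. *)
set (E := fun n => match n with
  | O => fun _ => 0
  | S n => fun s => 2 * besselI (S n) s + conv (besselI 1) (besselI (S n)) s
                    - conv (besselI 0) (besselI n) s
  end).
enough (E (S n) t = 0) by (unfold E in *; lra).
(* Index 0 is sent to itself, in accordance with [E 0 := 0]. The bound adds [2 * exp t] for the
   single Bessel function and [exp t * t] for each convolution. *)
apply (derive_system_unique E pred (fun n => match n with O => O | S n => S (S n) end)
         (2 * exp t + 2 * (exp t * t)) t); [| | |lra].
- intros [|m]; simpl; trivial. rewrite !conv_0, besselI_S_0. ring.
- assert (Hc := continuous_besselI). intros [|m] s.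
  + simpl. replace ((0 + 0) / 2) with 0 by field. now auto_derive.
  + assert (D1 := is_derive_besselI_S m s).
    assert (D2 := is_derive_conv_besselI_S (besselI 1) m s (Hc 1%nat)).
    assert (D3 : is_derive (conv (besselI 0) (besselI m)) s
              (match m with
               | O => besselI 0 s + conv (besselI 1) (besselI 0) s
               | S m => (conv (besselI 0) (besselI m) s
                         + conv (besselI 0) (besselI (S (S m))) s) / 2
               end)).
    (* For [m = 0] the source [I_0] produced here cancels the one in the derivative of [2 I_1]. *)
    { destruct m as [|m].
      - rewrite conv_comm by auto. apply is_derive_conv_besselI_0; auto.
      - apply is_derive_conv_besselI_S; auto. }
    unfold E; cbv beta iota; simpl pred.
    evar_last.
    * apply (is_derive_minus (K := R_AbsRing) (V := R_NormedModule)); [|exact D3].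
      apply (is_derive_plus (K := R_AbsRing) (V := R_NormedModule)); [|exact D2].
      apply (is_derive_scal (fun s => besselI (S m) s)). exact D1.
    * unfold minus, plus, opp; simpl; unfold mult; simpl.
      destruct m as [|m]; [rewrite (conv_comm (besselI 0) (besselI 1)) by auto|]; field.
- intros [|m] s Hs.
  + simpl. rewrite Rabs_R0. assert (0 < exp t) by apply exp_pos.
    assert (0 <= exp t * t) by (apply Rmult_le_pos; lra). lra.
  + assert (B1 := abs_besselI_le (S m) s ltac:(lra)).
    assert (B2 := abs_conv_besselI_le 1 (S m) s ltac:(lra)).
    assert (B3 := abs_conv_besselI_le 0 m s ltac:(lra)).
    assert (B4 := exp_mul_le s t Hs).
    assert (B5 : exp s <= exp t) by (apply exp_nondecreasing; lra).
    unfold E. apply Rabs_le_between in B1, B2, B3. apply Rabs_le_between. lra.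
Qed.

(** The derivative of a convolution can be placed on either factor. Comparing both forms for
    [I_(a+1) * I_(b+1)] and cancelling by the previous case moves one unit of order across; the base
    case compares them for [I_0 * I_(b+1)] and uses the quadratic identity. *)
Lemma conv_besselI_shift (a b : nat) (t : R) : 0 <= t ->
  conv (besselI (S a)) (besselI b) t = conv (besselI a) (besselI (S b)) t.
Proof.
assert (Hc := continuous_besselI). intros Ht. revert b.
assert (H0 : forall b, conv (besselI 1) (besselI b) t = conv (besselI 0) (besselI (S b)) t).
{ intros [|b]; [apply conv_comm; auto|].
  assert (D1 := is_derive_conv_besselI_S (besselI 0) b t (Hc 0%nat)).
  assert (D2 := is_derive_conv_besselI_0 (besselI (S b)) t (Hc (S b))).
  apply (is_derive_ext _ (conv (besselI 0) (besselI (S b)))) in D2;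
    [|intros; apply conv_comm; auto].
  apply is_derive_unique in D1, D2. rewrite D1 in D2.
  rewrite (conv_comm (besselI (S b)) (besselI 1)) in D2 by auto.
  assert (Q := besselI_conv_quadratic b t Ht). lra. }
induction a as [|a IH]; intros b; [apply H0|].
destruct b as [|b].
- rewrite conv_comm, <- H0 by auto. apply conv_comm; auto.
- assert (D1 := is_derive_conv_besselI_S (besselI (S a)) b t (Hc (S a))).
  assert (D2 := is_derive_conv_besselI_S (besselI (S b)) a t (Hc (S b))).
  apply (is_derive_ext _ (conv (besselI (S a)) (besselI (S b)))) in D2;
    [|intros; apply conv_comm; auto].
  apply is_derive_unique in D1, D2. rewrite D1 in D2.
  rewrite !(conv_comm (besselI (S b))) in D2 by auto.
  assert (Q := IH b). lra.
Qed.

(** By shifting, [I_a * I_b] depends on [a + b] only, so the case [a = 0] suffices. *)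
Lemma conv_besselI_add (a b : nat) (t : R) : 0 <= t ->
  conv (besselI a) (besselI b) t
  = 2 * besselI (S (a + b)) t + conv (besselI 1) (besselI (S (a + b))) t.
Proof.
intros Ht. rewrite <- besselI_conv_quadratic by trivial.
revert b; induction a as [|a IH]; intros b; trivial.
rewrite conv_besselI_shift, IH by trivial. do 2 f_equal; lia.
Qed.

(** * Associativity of convolution against a Bessel function *)

(** Puts an arbitrary continuous function into the form expected by [conv_growth]: its maximum on
    [[0, T]] serves as [A], because [exp s] is at least 1 there. *)
Lemma continuous_bounded_exp (f : R -> R) (T : R) : 0 <= T ->
  (forall s, continuous f s) ->
  exists A, 0 <= A /\ forall s, 0 <= s <= T -> Rabs (f s) <= A * exp s.
Proof.
intros HT Hf.
destruct (continuity_ab_maj (fun s => Rabs (f s)) 0 T HT) as [m [Hm _]].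
- intros s _. apply continuity_pt_filterlim.
  apply (continuous_comp f Rabs); auto. apply continuous_Rabs.
- exists (Rabs (f m)). split; [apply Rabs_pos|]. intros s Hs.
  assert (1 <= exp s) by (rewrite <- exp_0; apply exp_nondecreasing; lra).
  specialize (Hm s Hs). assert (H0 := Rabs_pos (f m)). simpl in Hm. nra.
Qed.

(* No Fubini: as functions indexed by [n], both sides solve the same differential system. *)
Lemma conv_assoc_besselI (f g : R -> R) (n : nat) (t : R) : 0 <= t ->
  (forall s, continuous f s) -> (forall s, continuous g s) ->
  (forall s, continuous (conv f g) s) ->
  conv (conv f g) (besselI n) t = conv f (conv g (besselI n)) t.
Proof.
intros Ht Hf Hg Hfg.
assert (Hc := continuous_besselI).
assert (Hgc := fun n s => continuous_conv_besselI g n s Hg).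
set (E := fun n s => conv (conv f g) (besselI n) s - conv f (conv g (besselI n)) s).
enough (E n t = 0) by (unfold E in *; lra).
destruct (continuous_bounded_exp f t Ht Hf) as [A [HA BA]].
destruct (continuous_bounded_exp g t Ht Hg) as [B [HB BB]].
destruct (continuous_bounded_exp (conv f g) t Ht Hfg) as [C [HC BC]].
(* The predecessor of 0 is taken to be 1, reflecting [I_(-1) = I_1], so that
   [E 0' = (E 1 + E 1) / 2]. *)
apply (derive_system_unique E (fun n => match n with O => 1%nat | S n => n end) S
         (C * (exp t * t) + A * (B * t) * (exp t * t)) t); [| | |lra].
- intros m. unfold E. rewrite !conv_0. ring.
- intros m s. unfold E. destruct m as [|m].
  + assert (D1 := is_derive_conv_besselI_0 (conv f g) s Hfg).
    (* Both derivatives contain the source [conv f g s], which cancels in the difference. The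
       coefficients 1 prepare for [conv_lin_r]. *)
    assert (D2 : is_derive (conv f (conv g (besselI 0))) s
              (f s * conv g (besselI 0) 0
               + conv f (fun s => 1 * g s + 1 * conv g (besselI 1) s) s)).
    { apply (is_derive_conv f (conv g (besselI 0))); trivial.
      - intros u. rewrite !Rmult_1_l. now apply is_derive_conv_besselI_0.
      - intros u. apply continuous_lin; auto. }
    rewrite conv_0, conv_lin_r in D2 by auto.
    evar_last.
    * apply (is_derive_minus (K := R_AbsRing) (V := R_NormedModule)); eassumption.
    * unfold minus, plus, opp; simpl. field.
  + assert (D1 := is_derive_conv_besselI_S (conv f g) m s Hfg).
    assert (D2 : is_derive (conv f (conv g (besselI (S m)))) s
              (f s * conv g (besselI (S m)) 0
               + conv f (fun s => / 2 * conv g (besselI m) s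
                                  + / 2 * conv g (besselI (S (S m))) s) s)).
    { apply (is_derive_conv f (conv g (besselI (S m)))); trivial.
      - intros u. replace (_ + _) with
          ((conv g (besselI m) u + conv g (besselI (S (S m))) u) / 2) by field.
        now apply is_derive_conv_besselI_S.
      - intros u. apply continuous_lin; auto. }
    rewrite conv_0, conv_lin_r in D2 by auto.
    evar_last.
    * apply (is_derive_minus (K := R_AbsRing) (V := R_NormedModule)); eassumption.
    * unfold minus, plus, opp; simpl. field.
- intros m s Hs.
  assert (Hb : forall u, 0 <= u <= s -> Rabs (besselI m u) <= 1 * exp u)
    by (intros u Hu; rewrite Rmult_1_l; apply abs_besselI_le; lra).
  assert (B1 : Rabs (conv (conv f g) (besselI m) s)
               <= C * 1 * exp s * s ^ 1 / INR (fact 1)).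
  { apply conv_growth; auto; [lra|].
    intros u Hu. simpl. rewrite Rmult_1_r, Rdiv_1_r. apply BC; lra. }
  assert (B2 : Rabs (conv f (conv g (besselI m)) s)
               <= A * (B * t) * exp s * s ^ 1 / INR (fact 1)).
  { apply conv_growth; auto; [lra| |].
    - intros u Hu. simpl. rewrite Rmult_1_r, Rdiv_1_r. apply BA; lra.
    - intros u Hu.
      assert (Bg : Rabs (conv g (besselI m) u) <= B * 1 * exp u * u ^ 1 / INR (fact 1)).
      { apply conv_growth; auto; [lra| |].
        - intros v Hv. simpl. rewrite Rmult_1_r, Rdiv_1_r. apply BB; lra.
        - intros v Hv. apply Hb; lra. }
      (* The factor [u] is bounded by [t], leaving a constant times [exp u] as [conv_growth]
         demands. *)
      eapply Rle_trans; [exact Bg|].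
      replace (B * 1 * exp u * u ^ 1 / INR (fact 1)) with (B * exp u * u)
        by (simpl; field).
      replace (B * t * exp u) with (B * exp u * t) by ring.
      apply Rmult_le_compat_l; [|lra].
      apply Rmult_le_pos; trivial. apply Rlt_le, exp_pos. }
  assert (B4 := exp_mul_le s t Hs).
  assert (H1 : C * 1 * exp s * s ^ 1 / INR (fact 1) <= C * (exp t * t)).
  { replace (C * 1 * exp s * s ^ 1 / INR (fact 1)) with (C * (exp s * s)) by (simpl; field).
    now apply Rmult_le_compat_l. }
  assert (H2 : A * (B * t) * exp s * s ^ 1 / INR (fact 1) <= A * (B * t) * (exp t * t)).
  { replace (A * (B * t) * exp s * s ^ 1 / INR (fact 1))
      with (A * (B * t) * (exp s * s)) by (simpl; field).
    apply Rmult_le_compat_l; trivial. repeat apply Rmult_le_pos; trivial. }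
  unfold E. apply Rabs_le_between in B1, B2. apply Rabs_le_between. lra.
Qed.

(** * Convolution powers of [I_1] and the telescoping series *)

Lemma continuous_conv_powS_besselI (k : nat) (t : R) :
  continuous (conv_powS (besselI 1) k) t.
Proof.
revert t; induction k as [|k IH]; intros t; simpl;
  [apply continuous_besselI | now apply continuous_conv_besselI].
Qed.

(** The [k + 1] factors are joined by only [k] convolutions, each contributing one integration;
    hence the exponent [k]. *)
Lemma abs_conv_powS_besselI_le (k : nat) (t : R) : 0 <= t ->
  Rabs (conv_powS (besselI 1) k t) <= 1 * exp t * t ^ k / INR (fact k).
Proof.
revert t; induction k as [|k IH]; intros t Ht.
- simpl. rewrite Rmult_1_l, Rmult_1_r, Rdiv_1_r. now apply abs_besselI_le.
- replace (1 * exp t) with (1 * 1 * exp t) by ring.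
  apply (conv_growth (conv_powS (besselI 1) k) (besselI 1)); trivial.
  + intros; apply continuous_conv_powS_besselI.
  + intros; apply continuous_besselI.
  + intros; apply IH; lra.
  + intros; rewrite Rmult_1_l; apply abs_besselI_le; lra.
Qed.

Lemma abs_conv_pow_besselI_le (l n : nat) (t : R) : 0 <= t ->
  Rabs (conv_pow (besselI 1) l (besselI n) t) <= exp t * (t ^ l / INR (fact l)).
Proof.
intros Ht. destruct l as [|l].
- simpl. rewrite Rdiv_1_r, Rmult_1_r. now apply abs_besselI_le.
- replace (exp t * (t ^ S l / INR (fact (S l))))
    with (1 * 1 * exp t * t ^ S l / INR (fact (S l)))
    by (unfold Rdiv; ring).
  apply (conv_growth (conv_powS (besselI 1) l) (besselI n)); trivial.
  + intros; apply continuous_conv_powS_besselI.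
  + intros; apply continuous_besselI.
  + intros; apply abs_conv_powS_besselI_le; lra.
  + intros; rewrite Rmult_1_l; apply abs_besselI_le; lra.
Qed.

(** The identity for [I_a * I_b] is convolved with [I_1^{*l}], and associativity absorbs its extra
    [I_1] into the power. *)
Lemma conv_pow_besselI_step (a b l : nat) (t : R) : 0 <= t ->
  conv_pow (besselI 1) l (conv (besselI a) (besselI b)) t
  = 2 * conv_pow (besselI 1) l (besselI (S (a + b))) t
    + conv_pow (besselI 1) (S l) (besselI (S (a + b))) t.
Proof.
intros Ht. destruct l as [|l].
- now apply conv_besselI_add.
- assert (Hc := continuous_besselI).
  assert (Hp := continuous_conv_powS_besselI).
  simpl. rewrite conv_assoc_besselI by (try apply (Hp (S l)); auto).
  rewrite (conv_ext_r _ _ (fun s => 2 * besselI (S (a + b)) s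
                             + 1 * conv (besselI 1) (besselI (S (a + b))) s)); trivial.
  + rewrite conv_lin_r; trivial; [ring|].
    intros; apply continuous_conv_besselI; auto.
  + intros s Hs. rewrite conv_besselI_add by lra. ring.
Qed.

(* [is_series a s]: the series with terms [a] converges, with sum [s]. *)
Theorem mainTheorem6 (x y : nat) (t : R) (hx : (1 <= x)%nat) (ht : 0 <= t) :
  is_series
    (fun l : nat =>
       (-1) ^ l / 2 ^ (l + 1) *
       conv_pow (besselI 1) l (conv (besselI (x - 1)) (besselI y)) t)
    (besselI (x + y) t).
Proof.
replace (x + y)%nat with (S (x - 1 + y)) by lia.
set (n := S (x - 1 + y)).
(* [r l] is the remainder before the term of index [l]; [r 0] is the claimed sum. *)
set (r := fun l => (- (1 / 2)) ^ l * conv_pow (besselI 1) l (besselI n) t).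
assert (Hr : is_lim_seq r 0).
{ apply is_lim_seq_abs_0.
  apply (is_lim_seq_le_le (fun _ => 0) _ (fun l => exp t * (t ^ l / INR (fact l)))).
  - intros l. split; [apply Rabs_pos|]. unfold r. rewrite Rabs_mult.
    rewrite <- (Rmult_1_l (exp t * _)).
    apply Rmult_le_compat; try apply Rabs_pos; [|now apply abs_conv_pow_besselI_le].
    rewrite <- RPow_abs, Rabs_Ropp, Rabs_pos_eq by lra.
    (* Bounding [(1 / 2) ^ l] by 1 is enough, as [t ^ l / l!] already tends to 0. *)
    apply Rle_trans with (1 ^ l); [apply pow_incr; lra | rewrite pow1; lra].
  - apply is_lim_seq_const.
  - rewrite <- (Rmult_0_r (exp t)).
    apply (is_lim_seq_scal_l _ (exp t) 0), is_lim_seq_Reals, cv_speed_pow_fact. }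
assert (Hsum : forall N, sum_n (fun l => (-1) ^ l / 2 ^ (l + 1) *
    conv_pow (besselI 1) l (conv (besselI (x - 1)) (besselI y)) t) N
    = besselI n t - r (S N)).
(* The factor 2 of the step identity turns the coefficient into [(- 1 / 2) ^ l]; without it the
   coefficient is [- (- 1 / 2) ^ (l + 1)]. *)
{ assert (Hterm : forall l, (-1) ^ l / 2 ^ (l + 1) *
      conv_pow (besselI 1) l (conv (besselI (x - 1)) (besselI y)) t = r l - r (S l)).
  { intros l. rewrite conv_pow_besselI_step by trivial. fold n. unfold r.
    replace (- (1 / 2)) with (-1 * / 2) by field.
    rewrite !Rpow_mult_distr, !pow_inv, pow_add, <- !tech_pow_Rmult. simpl (2 ^ 1).
    field. apply pow_nonzero; lra. }
  induction N as [|N IH].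
  - rewrite sum_O, Hterm. unfold r. simpl. ring.
  - rewrite sum_Sn, IH, Hterm. unfold plus; simpl. ring. }
change (is_lim_seq (sum_n (fun l => (-1) ^ l / 2 ^ (l + 1) *
    conv_pow (besselI 1) l (conv (besselI (x - 1)) (besselI y)) t)) (besselI n t)).
apply (is_lim_seq_ext (fun N => besselI n t - r (S N))); [intros; symmetry; apply Hsum|].
replace (Finite (besselI n t)) with (Finite (besselI n t - 0)) by (f_equal; ring).
apply is_lim_seq_minus'; [apply is_lim_seq_const|].
now apply (is_lim_seq_incr_1 r).
Qed.
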